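(* Let $k$ be a positive integer, $F=\{1,2,\dots,k\}$ and $\mathfrak{p}_F(x)=\prod_{j\in F}(x-j)$. Let $a,N$ be real numbers with $a\neq 0,-1$, $N\neq 1,2,\dots,k+1$, and $$k_k^{a,-N+k+1}(-n)\neq 0\quad\text{for all } n\ge 1,$$ where $k_k^{a,-N+k+1}$ is a Krawtchouk polynomial of degree $k$. Then the orthogonal polynomials $(q_n)_n$ with respect to the moment functional $\mathfrak{p}_F\,\rho_{a,N}$, where $\rho_{a,N}$ is the moment functional for the Krawtchouk polynomials, are common eigenfunctions of a difference operator of order $2k+2$ and genre $(-k-1,k+1)$; that is, there are such an operator $D$ and numbers $\lambda_n$ with $D(q_n)=\lambda_nq_n$ for all $n$ in the index range of the family $(q_n)_n$ (the family is finite when $N$ is a positive integer and infinite otherwise).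
   Context: For $l\in\mathbb{Z}$ the shift operator $\mathfrak{s}_l$ acts on polynomials by $\mathfrak{s}_l(f)(x)=f(x+l)$. A finite difference operator $\sum_{l=s}^r f_l\,\mathfrak{s}_l$ (with polynomial coefficients $f_l$ independent of $n$) with $f_s,f_r\neq 0$ has order $r-s$ and genre $(s,r)$. $(y)_j=y(y+1)\cdots(y+j-1)$, $(y)_0=1$. Krawtchouk polynomials ($a\neq 0,-1$, $N\in\mathbb{R}$): $k_n^{a,N}(x)=\frac{1}{n!}\sum_{j=0}^n(-1)^{n+j}\frac{(1+a)^{j-n}}{a^{j-n}}\frac{(-n)_j(-x)_j(N-n)_{n-j}}{j!}$. A moment functional is a linear map $\mu:\mathbb{P}\to\mathbb{R}$ on the space $\mathbb{P}$ of real polynomials; for a polynomial $r$, $\langle r\mu,p\rangle=\langle\mu,rp\rangle$. Krawtchouk moment functional $\rho_{a,N}$ ($a\neq 0,-1$): if $N$ is not a positive integer, it is the unique moment functional with respect to which $(k_n^{a,N})_n$ are orthogonal, normalized by $\langle\rho_{a,N},1\rangle=1$; if $N$ is a positive integer, it is the measure $\rho_{a,N}=\frac{\Gamma(N)}{(1+a)^{N-1}}\sum_{x=0}^{N-1}\frac{a^x}{\Gamma(N-x)x!}\delta_x$. Orthogonal polynomials with respect to $\mu$ are polynomials $(q_n)_n$ (a finite family $0\le n\le K$ or an infinite one) with $\deg q_n=n$, $\langle\mu,q_nx^m\rangle=0$ for $0\le m<n$ and $\langle\mu,q_nx^n\rangle\neq 0$ for all indicated $n$ (each $q_n$ is then unique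 up to a nonzero constant factor). *)

(* Defs.v *)
From HB Require Import structures.
From mathcomp Require Import all_boot all_order all_algebra.
From mathcomp Require Import reals.

Set Implicit Arguments.
Unset Strict Implicit.
Unset Printing Implicit Defensive.

Import Order.TTheory GRing.Theory Num.Theory.
Local Open Scope ring_scope.

Definition poch (A : comNzRingType) (y : A) (j : nat) : A :=
  \prod_(i < j) (y + i%:R).

(* In the summand j <= n, so z ^- (n - j) is the power of z with the
   (nonpositive) exponent j - n, and 'X below is the variable of k_n^{a,N}. *)
Definition krawtchouk (R : realType) (a N : R) (n : nat) : {poly R} :=
  (n`!%:R)^-1 *:
  \sum_(j < n.+1)
     ((-1) ^+ (n + j) * ((1 + a) ^- (n - j) / a ^- (n - j))
        * (poch (- n%:R) j * poch (N - n%:R) (n - j) / j`!%:R))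
     *: poch (- 'X : {poly R}) j.

(* A moment functional is a linear form mu : {scalar {poly R}}.
   mulmf r mu is the functional r mu, p |-> <mu, r p>. *)
Definition mulmf (R : realType) (r : {poly R}) (mu : {scalar {poly R}})
    (p : {poly R}) : R := mu (r * p).

Lemma mulmf_is_scalar (R : realType) (r : {poly R}) (mu : {scalar {poly R}}) :
  scalar (mulmf r mu).
Proof.
by move=> c p q; rewrite /mulmf mulrDr -scalerAr linearP.
Qed.

HB.instance Definition _ (R : realType) (r : {poly R})
    (mu : {scalar {poly R}}) :=
  GRing.isLinear.Build R {poly R} R *%R (mulmf r mu) (mulmf_is_scalar r mu).

(* Index range of a family of polynomials: Some K stands for 0 <= n <= K and
   None for all n. *)
Definition in_range (K : option nat) (n : nat) : bool :=
  if K is Some m then (n <= m)%N else true.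

Definition orthogonal_polys (R : realType) (mu : {scalar {poly R}})
    (K : option nat) (q : nat -> {poly R}) : Prop :=
  forall n, in_range K n ->
    [/\ size (q n) = n.+1,
        forall m, (m < n)%N -> mu (q n * 'X^m) = 0
      & mu (q n * 'X^n) != 0].

(* The case N = M.+1; the values of the Gamma function at the positive integers
   N and N - x = (M - x).+1 are the factorials of M and M - x. *)
Definition krawtchouk_measure (R : realType) (a : R) (M : nat)
    (p : {poly R}) : R :=
  M`!%:R / (1 + a) ^+ M *
  \sum_(x < M.+1) a ^+ x / ((M - x)`!%:R * x`!%:R) * p.[x%:R].

(* Characterizes the Krawtchouk moment functional rho_{a,N} uniquely. *)
Definition krawtchouk_functional (R : realType) (a N : R)
    (rho : {scalar {poly R}}) : Prop :=
  (forall M : nat, N = M.+1%:R -> rho =1 krawtchouk_measure a M) /\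
  ((forall M : nat, N <> M.+1%:R) ->
     orthogonal_polys rho None (krawtchouk a N) /\ rho 1 = 1).

Definition shiftp (R : realType) (l : int) (f : {poly R}) : {poly R} :=
  f \Po ('X + (l%:~R)%:P).

(* \sum_(l = s .. r) f_l s_l, where s <= r is intended; l = s + i. *)
Definition diff_op (R : realType) (s r : int) (f : int -> {poly R})
    (p : {poly R}) : {poly R} :=
  \sum_(i < `|r - s|%N.+1) f (s + i%:Z) * shiftp (s + i%:Z) p.

Definition has_genre (R : realType) (D : {poly R} -> {poly R})
    (s r : int) : Prop :=
  s <= r /\
  exists f : int -> {poly R},
    [/\ f s != 0, f r != 0 & D =1 diff_op s r f].

Definition has_order (R : realType) (D : {poly R} -> {poly R})
    (m : nat) : Prop :=
  exists s r : int, has_genre D s r /\ r - s = m%:Z.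

(* p_F for F = {1, ..., k} *)
Definition pF (R : realType) (k : nat) : {poly R} :=
  \prod_(1 <= j < k.+1) ('X - (j%:R)%:P).

(* Main.v *)
Require Import Defs.
From HB Require Import structures.
From mathcomp Require Import all_boot all_order all_algebra.
From mathcomp Require Import boolp reals ring zify.

Set Implicit Arguments.
Unset Strict Implicit.
Unset Printing Implicit Defensive.

Import Order.TTheory GRing.Theory Num.Theory.
Local Open Scope ring_scope.

(** Put d = N - 1 and let B_n^d be the polynomials with generating function
    sum_n B_n^d(x) t^n / n! = (1 + t)^x (1 - a t)^(d - x). Up to constants,
    B_n^d is the Krawtchouk polynomial k_n^(a,N) ([kpoly_krawtchouk]). Whether
    or not N is a positive integer, the functional rho satisfies rho(1) = 1
    and the Pearson equation rho(x g(x-1)) = a rho((d - x) g(x))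
    ([pearson_krawtchouk_functional]), and nothing else about rho is used.

    The orthogonal polynomials. The polynomial x p_F(x) = x(x-1)...(x-k) turns
    rho into a Krawtchouk functional with N lowered by k + 1, translated by k
    + 1; its orthogonal polynomials are p_n(x) = B_n^(d-k-1)(x - k - 1). Any
    combination of p_n and p_(n-1) is therefore orthogonal, for p_F rho, to
    the multiples of x of degree below n, and orthogonality to 1 fixes the
    combination. The values of p_F rho on the p_n are (-1)^n n! E(-n-1), where
    E is the monic multiple of k_k^(a,-N+k+1) ([pearson_pF]), so that
      q_n = E(-n) p_n + n E(-n-1) p_(n-1).
    The hypothesis on k_k^(a,-N+k+1) says that E(-n) is not zero for n >= 1,
    and N <> 1, ..., k gives the same at 0; hence q_n has degree n. The norms
    are nonzero exactly as long as those of the p_(n-1) are, which bounds n by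
    N - 1 - k when N is a positive integer ([christoffel_poly_orthogonal]).

    The operator. Let L be the second-order operator with L p_n = n p_n and
    put Y(n) = E(-n-1). Then Y(L) q_n = Y(n) Y(n-1) (p_n + n p_(n-1)), and the
    backward shift s_(-1) sends p_n + n p_(n-1) to p_n - a n p_(n-1)
    ([backshift_shifted_kpoly]). So D = P(L) + s_(-1) Y(L) multiplies the p_n
    term of q_n by P(n) + Y(n) and its p_(n-1) term by P(n-1) - a Y(n-1).
    These agree as soon as P(n) - P(n-1) = - Y(n) - a Y(n-1), a difference
    equation with a polynomial solution of degree k + 1. Since L has genre
    (-1,1) and Y has degree k, D has genre (-k-1,k+1): at the shift k + 1 only
    P(L) contributes, and at -k-1 the two contributions have different degrees
    ([difference_operator]). *)

(** * Shifts and differences of polynomials *)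
Lemma poly_ext (R : numDomainType) (p q : {poly R}) :
  (forall x, p.[x] = q.[x]) -> p = q.
Proof.
move=> epq; apply/eqP; rewrite -subr_eq0; apply/eqP.
apply: (@roots_geq_poly_eq0 _ _ [seq i%:R | i <- iota 0 (size (p - q))]).
- by apply/allP => _ /mapP[i _ ->]; rewrite /root hornerD hornerN epq subrr.
- by rewrite map_inj_uniq ?iota_uniq // => i j /eqP; rewrite eqr_nat => /eqP.
- by rewrite size_map size_iota.
Qed.

Section Krawtchouk.
Variables (R : realType) (a : R).
Implicit Types (d x : R) (f g r : {poly R}) (n k : nat).

Lemma horner_shiftp (l : int) f x : (shiftp l f).[x] = f.[x + l%:~R].
Proof. by rewrite /shiftp horner_comp !hornerE. Qed.

Lemma shiftp_shiftp (l m : int) f : shiftp l (shiftp m f) = shiftp (l + m) f.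
Proof. by apply: poly_ext => x; rewrite !horner_shiftp rmorphD addrA. Qed.

Lemma shiftp0 f : shiftp 0 f = f.
Proof. by apply: poly_ext => x; rewrite horner_shiftp addr0. Qed.

Lemma shiftpM (l : int) f g : shiftp l (f * g) = shiftp l f * shiftp l g.
Proof. exact: rmorphM. Qed.

Lemma coef_comp_linear f g n : size g = 2%N -> (size f <= n.+1)%N ->
  (f \Po g)`_n = f`_n * lead_coef g ^+ n.
Proof.
move=> sg; rewrite leq_eqVlt => /orP[/eqP sf|sf]; last first.
  by rewrite !nth_default ?mul0r // size_comp_poly2.
have := lead_coef_comp f (q := g); rewrite sg => /(_ isT).
by rewrite !lead_coefE size_comp_poly2 // sf.
Qed.

Lemma size_shiftp (l : int) f : size (shiftp l f) = size f.
Proof. by rewrite /shiftp size_comp_poly2 // size_XaddC. Qed.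

Lemma coef_shiftp (l : int) f n : (size f <= n.+1)%N -> (shiftp l f)`_n = f`_n.
Proof.
move=> sf; rewrite coef_comp_linear ?size_XaddC //.
by rewrite lead_coefXaddC expr1n mulr1.
Qed.

Lemma shiftpZ (l : int) c f : shiftp l (c *: f) = c *: shiftp l f.
Proof. exact: linearZ. Qed.

Definition fdiff f := shiftp 1 f - f.

Lemma horner_fdiff f x : (fdiff f).[x] = f.[x + 1] - f.[x].
Proof. by rewrite !hornerE horner_shiftp. Qed.

Lemma coef_fdiff f n : (size f <= n.+2)%N -> (fdiff f)`_n = f`_n.+1 *+ n.+1.
Proof.
move=> sf; set g := take_poly n.+1 f.
have -> : f = g + f`_n.+1 *: 'X^(n.+1).
  apply/polyP => i; rewrite coefD coefZ coefXn coef_take_poly ltnS.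
  have [->|ne] := eqVneq i n.+1; first by rewrite ltnn mulr1 add0r.
  rewrite mulr0 addr0; case: leqP => // lt.
  by rewrite nth_default // (leq_trans sf) //; lia.
have sg : (size g <= n.+1)%N by apply: size_take_poly.
rewrite [fdiff _](_ : _ = fdiff g + f`_n.+1 *: fdiff 'X^(n.+1)); last first.
  by apply: poly_ext => x; rewrite !(horner_fdiff, hornerE); ring.
rewrite coefD coefB coef_shiftp // subrr add0r coefZ.
rewrite coefB coefXn ltn_eqF // subr0 coefD coefZ coefXn eqxx mulr1.
rewrite (nth_default _ sg) add0r.
rewrite /shiftp comp_Xn_poly rmorph1 exprD1n coef_sum.
rewrite (bigD1 (inord n)) //= inordK //.
rewrite coefMn coefXn eqxx binSn big1 ?addr0 ?mulr_natr // => i ne.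
rewrite coefMn coefXn; case: eqP => [e|]; last by rewrite mul0rn.
by case/eqP: ne; apply: val_inj; rewrite /= inordK.
Qed.

Lemma size_fdiff f n : (size f <= n.+1)%N -> (size (fdiff f) <= n)%N.
Proof.
move=> sf; apply/leq_sizeP => j; rewrite leq_eqVlt => /orP[/eqP<-|lt].
  by rewrite coefB coef_shiftp // subrr.
by rewrite nth_default // (leq_trans (size_polyD _ _)) // size_polyN size_shiftp
  maxnn (leq_trans sf).
Qed.

(** * Krawtchouk polynomials from a raising operator *)

(** This operator multiplies by x with a backward shift and subtracts a(d -
    x); it sends B_n^(d-1) to B_(n+1)^d, and the Pearson equation below says
    that a functional vanishes on its range. *)
Definition raise d g := 'X * shiftp (-1) g - a *: ((d%:P - 'X) * g).

Lemma horner_raise d g x :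
  (raise d g).[x] = x * g.[x - 1] - a * ((d - x) * g.[x]).
Proof. by rewrite !hornerE horner_shiftp. Qed.

Let horner1 x : (1 : {poly R}).[x] = 1. Proof. exact: hornerC. Qed.

(** Polynomial identities are verified by evaluation at an arbitrary point,
    which reduces them to ring identities between values. *)
Let evalE := (horner_raise, horner_fdiff, horner_shiftp, horner1, hornerD,
  hornerN, hornerX, hornerC, hornerZ, hornerM).

(** The polynomials B_n^d with generating function sum_n B_n^d(x) t^n / n! =
    (1 + t)^x (1 - a t)^(d - x); differentiating it in t gives the recursion.
    They are multiples of the Krawtchouk polynomials with N = d + 1, and d is
    allowed to vary because every structure relation below moves it. *)
Fixpoint kpoly n d : {poly R} :=
  if n is m.+1 then raise d (kpoly m (d - 1)) else 1.

Lemma raise_linear d c f g : raise d (c *: f + g) = c *: raise d f + raise d g.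
Proof. by apply: poly_ext => x; rewrite !evalE; ring. Qed.

(** The commutation of the difference with the raising operator is the source
    of both the lowering relation and the second-order equation. *)
Lemma fdiff_raise d g :
  fdiff (raise d g) = (1 + a) *: g + raise (d - 1) (fdiff g).
Proof.
apply: poly_ext => x.
by rewrite !evalE addrK subrK; ring.
Qed.

Lemma fdiff_kpoly n d :
  fdiff (kpoly n.+1 d) = ((1 + a) * n.+1%:R) *: kpoly n (d - 1).
Proof.
elim: n d => [|n IHn] d; rewrite [kpoly _.+1 d]/= fdiff_raise.
  by apply: poly_ext => x; rewrite !evalE; ring.
rewrite IHn; apply: poly_ext => x; rewrite /= !evalE.
by rewrite -[n.+2%:R]natr1; ring.
Qed.

(** On generating functions: raising d by one multiplies by 1 - a t. *)
Lemma kpoly_contiguous n d :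
  kpoly n.+1 (d + 1) = kpoly n.+1 d - (a * n.+1%:R) *: kpoly n d.
Proof.
elim: n d => [|n IHn] d.
  by apply: poly_ext => x; rewrite /= !evalE; ring.
rewrite [kpoly n.+2 (d + 1)]/= addrK.
have e : kpoly n.+1 d = kpoly n.+1 (d - 1) - (a * n.+1%:R) *: kpoly n (d - 1).
  by rewrite -IHn subrK.
have -> : raise (d + 1) (kpoly n.+1 d)
    = raise d (kpoly n.+1 d) - a *: kpoly n.+1 d.
  by apply: poly_ext => x; rewrite !evalE; ring.
rewrite {1}e; apply: poly_ext => x.
rewrite [kpoly n.+2 d]/= -[kpoly n.+1 d]/(raise d (kpoly n (d - 1))).
by rewrite !evalE -[n.+2%:R]natr1; ring.
Qed.

(** Lowering then raising returns to the same index, so the Krawtchouk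
    polynomials are eigenfunctions of the second-order operator [raise d \o
    fdiff]. *)
Lemma kpoly_eigen n d :
  raise d (fdiff (kpoly n d)) = ((1 + a) * n%:R) *: kpoly n d.
Proof.
case: n => [|n].
  by apply: poly_ext => x; rewrite !evalE; ring.
by rewrite fdiff_kpoly; apply: poly_ext => x; rewrite !evalE; ring.
Qed.

Lemma size_coef_kpoly n d :
  (size (kpoly n d) <= n.+1)%N /\ (kpoly n d)`_n = (1 + a) ^+ n.
Proof.
elim: n d => [|n IHn] d /=; first by rewrite size_poly1 coef1.
have [sB cB] := IHn (d - 1); set B := kpoly n _ in sB cB *.
have e : raise d B = (shiftp (-1) B + a *: B) * 'X - (a * d) *: B.
  by apply: poly_ext => x; rewrite !evalE ; ring.
rewrite e; split.
  rewrite (leq_trans (size_polyD _ _)) // geq_max size_polyN; apply/andP; split.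
    rewrite (leq_trans (size_polyMleq _ _)) // size_polyX addn2 /= ltnS.
    rewrite (leq_trans (size_polyD _ _)) // geq_max size_shiftp sB.
    exact: leq_trans (size_scale_leq _ _) sB.
  exact: leq_trans (size_scale_leq _ _) (leqW sB).
rewrite coefB coefMX /= coefD coefZ coef_shiftp // cB !coefZ.
by rewrite (nth_default _ sB) exprS; ring.
Qed.

(** * Functionals satisfying a Pearson equation *)

Implicit Types (mu nu rho : {scalar {poly R}}).

(** The equation satisfied by the weight a^x binomial(d, x). It is stated for
    functionals, where it makes sense for every real d. *)
Definition pearson d nu :=
  forall g, nu ('X * shiftp (-1) g) = a * nu ((d%:P - 'X) * g).

Definition falling d n : R := \prod_(i < n) (d - i%:R).

Lemma fallingS d n : falling d n.+1 = d * falling (d - 1) n.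
Proof.
rewrite /falling big_ord_recl subr0; congr (_ * _); apply: eq_bigr => i _.
by rewrite lift0 -natr1; ring.
Qed.

(** Multiplying a Pearson functional by d - x lowers d: for the weights, (d -
    x) binomial(d, x) = d binomial(d - 1, x). *)
Lemma pearson_mulmf d nu :
  pearson d nu -> pearson (d - 1) (mulmf (d%:P - 'X) nu).
Proof.
move=> P g; rewrite /= /mulmf.
have -> : (d%:P - 'X) * ('X * shiftp (-1) g)
    = 'X * shiftp (-1) (((d - 1)%:P - 'X) * g).
  by apply: poly_ext => x; rewrite !evalE; ring.
by rewrite P.
Qed.

Hypothesis a1 : 1 + a != 0.

Lemma pearson_mulmf1 d nu : pearson d nu ->
  mulmf (d%:P - 'X) nu 1 = d / (1 + a) * nu 1.
Proof.
move=> P; have := P 1; rewrite /mulmf !mulr1.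
have -> : 'X * shiftp (-1) 1 = 'X :> {poly R}.
  by apply: poly_ext => x; rewrite !evalE; ring.
have -> : d%:P - 'X = d *: 1 - 'X by rewrite -mul_polyC mulr1.
rewrite linearB linearZ /= => e; apply: (mulfI a1).
have -> : (1 + a) * (d * nu 1 - nu 'X)
    = d * nu 1 + (a * (d * nu 1 - nu 'X) - nu 'X) by ring.
by rewrite -e subrr addr0; field; exact: a1.
Qed.

(** The raising operator is, up to the factor a, the adjoint of the
    difference. *)
Lemma pearson_raise d nu g r : pearson d nu ->
  nu (raise d g * r) = a * mulmf (d%:P - 'X) nu (g * fdiff r).
Proof.
move=> P; rewrite /mulmf.
have -> : raise d g * r = 'X * shiftp (-1) (g * shiftp 1 r)
                           - a *: ((d%:P - 'X) * (g * r)).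
  by apply: poly_ext => x; rewrite !evalE subrK; ring.
rewrite linearB linearZ P /= -mulrBr -linearB; congr (a * nu _).
by rewrite /fdiff; ring.
Qed.

(** A Rodrigues formula: moving the n raising operators to the other factor
    takes n differences of r, and only the leading coefficient survives. It
    gives at once the orthogonality (r of degree below n) and the norms. *)
Lemma pearson_kpoly n d nu r : pearson d nu -> (size r <= n.+1)%N ->
  nu (kpoly n d * r) =
    (a / (1 + a)) ^+ n * falling d n * n`!%:R * r`_n * nu 1.
Proof.
elim: n d nu r => [|n IHn] d nu r P sr.
  rewrite mul1r (size1_polyC sr) coefC /falling big_ord0 expr0 !mul1r.
  by rewrite -[polyC _]mulr1 mul_polyC linearZ.
rewrite [kpoly _ _]/= pearson_raise // IHn; first last.
- exact: size_fdiff.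
- exact: pearson_mulmf.
rewrite /= pearson_mulmf1 // coef_fdiff // fallingS exprS factS natrM.
rewrite -mulr_natr.
by field; exact: a1.
Qed.

Definition falling_poly k : {poly R} := \prod_(i < k) ('X - (i%:R)%:P).

Lemma falling_polyS k : falling_poly k.+1 = 'X * shiftp (-1) (falling_poly k).
Proof.
rewrite /falling_poly big_ord_recl subr0; congr (_ * _).
rewrite /shiftp rmorph_prod; apply: eq_bigr => i _.
by apply: poly_ext => x; rewrite horner_comp !evalE lift0 -natr1; ring.
Qed.

Lemma falling_poly_pF k : falling_poly k.+1 = 'X * pF R k.
Proof.
rewrite /falling_poly big_ord_recl subr0; congr (_ * _).
by rewrite /pF -(big_mkord xpredT (fun i => 'X - (i.+1%:R)%:P)) big_add1.
Qed.

(** For the weights, x(x-1)...(x-k+1) binomial(d, x) is a multiple of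
    binomial(d - k, x - k): the functional multiplied by this polynomial is,
    after a translation by k, a Krawtchouk functional again. *)
Lemma pearson_falling k d nu : pearson d nu ->
  exists nu' : {scalar {poly R}},
    [/\ pearson (d - k%:R) nu',
        nu' 1 = (a / (1 + a)) ^+ k * falling d k * nu 1
      & forall g, nu (falling_poly k * shiftp (- k%:Z) g) = nu' g].
Proof.
elim: k d nu => [|k IHk] d nu P.
  exists nu; rewrite subr0 /falling /falling_poly big_ord0 expr0 !mul1r.
  split=> // g.
  by rewrite big_ord0 shiftp0 mul1r.
have [nu' [P' nu1 nuE]] := IHk _ _ (pearson_mulmf P).
(* The constant polynomial a, used as a multiplier, rescales the functional. *)
exists (mulmf a%:P nu'); rewrite /= /mulmf; split.
- move=> g; rewrite /= /mulmf !mul_polyC !linearZ /=; congr (a * _).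
  by rewrite P' -natr1 opprD [- k%:R - 1]addrC addrA.
- rewrite mul_polyC linearZ /= nu1 /= pearson_mulmf1 // exprS fallingS.
  by field; exact: a1.
- move=> g; rewrite mul_polyC linearZ /= -nuE -P /= /mulmf falling_polyS.
  rewrite -mulrA shiftpM shiftp_shiftp; congr (nu (_ * (_ * shiftp _ _))); lia.
Qed.

(** * The values of p_F rho on translated Krawtchouk polynomials *)

(** On generating functions: the factor 1 + t is a translation of x by one
    together with a translation of d. *)
Lemma kpoly_shift n d :
  kpoly n.+1 d + n.+1%:R *: kpoly n d = shiftp 1 (kpoly n.+1 (d + 1)).
Proof.
have := fdiff_kpoly n (d + 1); rewrite addrK => e.
rewrite -[shiftp 1 _](subrK (kpoly n.+1 (d + 1))) -/(fdiff _) e.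
by rewrite kpoly_contiguous; apply: poly_ext => x; rewrite !evalE; ring.
Qed.

(** The Krawtchouk polynomials of the functional of [pearson_falling], in the
    original variable: B_n^(d-j)(x - j). *)
Definition shifted_kpoly d j n := shiftp (- j%:Z) (kpoly n (d - j%:R)).

Lemma shifted_kpoly_rec d j n :
  shifted_kpoly d j n.+1 =
  shifted_kpoly d j.+1 n.+1 + n.+1%:R *: shifted_kpoly d j.+1 n.
Proof.
have -> : shifted_kpoly d j n.+1
    = shiftp (- j.+1%:Z) (shiftp 1 (kpoly n.+1 (d - j.+1%:R + 1))).
  rewrite /shifted_kpoly shiftp_shiftp -natr1.
  congr (shiftp _ (kpoly _ _)); last ring.
  by lia.
by rewrite -kpoly_shift; apply: poly_ext => x; rewrite !evalE.
Qed.

Lemma kpoly_at0 n d : (kpoly n d).[0] = (- a) ^+ n * falling d n.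
Proof.
elim: n d => [|n IHn] d; first by rewrite horner1 /falling big_ord0 mulr1.
by rewrite [kpoly _ _]/= !evalE mul0r IHn fallingS exprS; ring.
Qed.

Lemma falling_rev d n : falling (n%:R - 1 - d) n = (-1) ^+ n * falling d n.
Proof.
rewrite /falling [in RHS](reindex_inj rev_ord_inj) /= -[n in _ ^+ n]card_ord.
rewrite -prodrN; apply: eq_bigr => i _.
by rewrite natrB // -natr1; ring.
Qed.

(** The values of p_F rho on the translated Krawtchouk polynomials are, up to
    (-1)^n n!, those of this Krawtchouk polynomial at -n-1. The factor makes
    it monic. *)
Definition dual_kpoly d k : {poly R} := (1 + a) ^- k *: kpoly k (k%:R - 1 - d).

Lemma dual_kpoly_at0 d k :
  (dual_kpoly d k).[0] = (a / (1 + a)) ^+ k * falling d k.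
Proof.
rewrite hornerZ kpoly_at0 falling_rev expr_div_n [(- a) ^+ k]exprNn.
have := sqrr_sign R k; rewrite expr2 => e.
by transitivity ((-1) ^+ k * (-1) ^+ k * (a ^+ k / (1 + a) ^+ k * falling d k));
  [ring | rewrite e mul1r].
Qed.

Lemma fdiff_dual_kpoly d k :
  fdiff (dual_kpoly d k.+1) = k.+1%:R *: dual_kpoly d k.
Proof.
have -> : fdiff (dual_kpoly d k.+1)
    = (1 + a) ^- k.+1 *: fdiff (kpoly k.+1 (k.+1%:R - 1 - d)).
  by apply: poly_ext => x; rewrite !evalE; ring.
rewrite fdiff_kpoly /dual_kpoly -natr1.
have -> : k%:R + 1 - 1 - d - 1 = k%:R - 1 - d by ring.
rewrite !scalerA exprS; congr (_ *: _); field.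
by rewrite expf_neq0 a1.
Qed.

(** The translated Rodrigues formula: it gives orthogonality and norms of the
    translated family for the functional multiplied by x(x-1)...(x-j+1). *)
Lemma pearson_shifted_kpoly d nu j n r : pearson d nu -> (size r <= n.+1)%N ->
  nu (falling_poly j * (shifted_kpoly d j n * r)) =
    (a / (1 + a)) ^+ n * falling (d - j%:R) n * n`!%:R * r`_n
      * ((a / (1 + a)) ^+ j * falling d j * nu 1).
Proof.
move=> P sr; have [nu' [P' <- nuE]] := pearson_falling j P.
have -> : shifted_kpoly d j n * r
    = shiftp (- j%:Z) (kpoly n (d - j%:R) * shiftp j%:Z r).
  by rewrite shiftpM shiftp_shiftp addNr shiftp0.
by rewrite nuE pearson_kpoly ?size_shiftp // coef_shiftp.
Qed.

Lemma pearson_shifted_kpoly0 d nu j n : pearson d nu ->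
  nu (falling_poly j * shifted_kpoly d j n) =
    (n == 0)%:R * ((a / (1 + a)) ^+ j * falling d j) * nu 1.
Proof.
move=> P; rewrite -[shifted_kpoly _ _ _]mulr1.
rewrite pearson_shifted_kpoly ?size_poly1 // coef1.
case: n => [|n]; rewrite ?fact0 ?mulr0 ?mul0r //.
by rewrite [falling _ 0]big_ord0 expr0 eqxx; ring.
Qed.

Lemma pFS k : pF R k.+1 = pF R k * ('X - (k.+1%:R)%:P).
Proof. by rewrite /pF big_nat_recr. Qed.

Lemma pF0 : pF R 0 = 1.
Proof. by rewrite /pF big_geq. Qed.

(** These moments decide which combination of two consecutive polynomials is
    orthogonal to 1. Both sides obey the same recursion in k and n: on the
    left because [falling_poly k.+1] is [pF R k.+1] plus k + 1 times [pF R k],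
    on the right because the dual polynomials satisfy [fdiff_dual_kpoly]; the
    inhomogeneous term at n = 0 is [dual_kpoly_at0]. *)
Lemma pearson_pF d nu k n : pearson d nu ->
  nu (pF R k * shifted_kpoly d k.+1 n) =
    (-1) ^+ n * n`!%:R * (dual_kpoly d k).[- n.+1%:R] * nu 1.
Proof.
move=> P; elim: k n => [|k IHk].
  have D0 x : (dual_kpoly d 0).[x] = 1.
    by rewrite hornerZ horner1 expr0 invr1 mulr1.
  have sk0 m : nu (shifted_kpoly d 0 m) = (m == 0)%:R * nu 1.
    have := pearson_shifted_kpoly0 0 m P.
    rewrite /falling_poly /falling !big_ord0 mul1r => ->.
    by rewrite expr0; ring.
  elim=> [|n IHn]; rewrite D0.
    by rewrite pF0 [shifted_kpoly _ _ _]rmorph1 mulr1 fact0 expr0; ring.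
  have := sk0 n.+1; rewrite shifted_kpoly_rec linearD linearZ /=.
  move: IHn; rewrite pF0 !mul1r D0 => -> /eqP.
  by rewrite mul0r addr_eq0 => /eqP->; rewrite factS natrM exprS; ring.
(* This is falling_poly (k+1) = X pF(k) = pF(k+1) + (k+1) pF(k), tested against
   shifted_kpoly d (k+1) n. *)
have rel n : nu (pF R k.+1 * shifted_kpoly d k.+1 n)
      + k.+1%:R * nu (pF R k * shifted_kpoly d k.+1 n)
    = (n == 0)%:R * ((a / (1 + a)) ^+ k.+1 * falling d k.+1) * nu 1.
  rewrite -pearson_shifted_kpoly0 // -linearZ -linearD; congr (nu _).
  by rewrite falling_poly_pF pFS -mul_polyC; ring.
have dual x : (dual_kpoly d k.+1).[x + 1] - (dual_kpoly d k.+1).[x]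
    = k.+1%:R * (dual_kpoly d k).[x].
  by rewrite -horner_fdiff fdiff_dual_kpoly hornerZ.
elim=> [|n IHn].
  have := rel 0%N; rewrite IHk mul1r -dual_kpoly_at0.
  have := dual (- 1%:R); rewrite addNr => /eqP; rewrite subr_eq => /eqP->.
  rewrite [shifted_kpoly d k.+2 0](_ : _ = shifted_kpoly d k.+1 0); last first.
    by apply: poly_ext => x; rewrite !horner_shiftp !horner1.
  rewrite fact0 => e.
  apply: (addIr (k.+1%:R * (1 * (dual_kpoly d k).[- 1%:R] * nu 1))).
  by rewrite e eqxx -[true%:R]/(1 : R); ring.
have := rel n.+1; rewrite IHk !mul0r shifted_kpoly_rec.
rewrite mulrDr linearD -scalerAr linearZ /= IHn => /eqP.
rewrite -addrA addr_eq0 => /eqP->.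
have := dual (- n.+2%:R); have -> : - n.+2%:R + 1 = - n.+1%:R :> R.
  by rewrite -[n.+2%:R]natr1; ring.
move=> /eqP; rewrite subr_eq => /eqP ->.
by rewrite factS natrM exprS; ring.
Qed.

(** * The hypergeometric form and the Krawtchouk functional *)

Lemma raise_sum d m (c : nat -> R) (p : nat -> {poly R}) :
  raise d (\sum_(j < m) c j *: p j) = \sum_(j < m) c j *: raise d (p j).
Proof.
elim: m => [|m IHm].
  by rewrite !big_ord0; apply: poly_ext => x; rewrite !(horner0, evalE); ring.
by rewrite !big_ord_recr /= addrC raise_linear IHm addrC.
Qed.

Lemma pochS (A : comNzRingType) (y : A) j : poch y j.+1 = poch y j * (y + j%:R).
Proof. by rewrite /poch big_ord_recr. Qed.

Lemma pochSl (A : comNzRingType) (y : A) j : poch y j.+1 = y * poch (y + 1) j.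
Proof.
rewrite /poch big_ord_recl addr0; congr (_ * _); apply: eq_bigr => i _.
by rewrite lift0 -natr1; ring.
Qed.

Lemma shift_poch j :
  shiftp (-1) (poch (- 'X) j) = poch (- 'X + 1) j :> {poly R}.
Proof.
rewrite /poch /shiftp rmorph_prod; apply: eq_bigr => i _.
rewrite rmorphD rmorphN /= comp_polyX rmorph_nat -polyC_natr.
by apply: poly_ext => x; rewrite !evalE; ring.
Qed.

(** In the basis of the rising factorials of -x the raising operator is
    bidiagonal, which makes the hypergeometric form of B_n^d an induction. *)
Lemma raise_poch d j :
  raise d (poch (- 'X) j) =
  (- (1 + a)) *: poch (- 'X) j.+1 + (- (a * (d - j%:R))) *: poch (- 'X) j.
Proof.
rewrite /raise shift_poch; have e := pochSl (- 'X : {poly R}) j.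
transitivity (- poch (- 'X) j.+1 - a *: ((d%:P - 'X) * poch (- 'X) j)).
  by rewrite e mulNr opprK.
rewrite pochS -polyC_natr.
by apply: poly_ext => x; rewrite !evalE; ring.
Qed.

Lemma kpoly_poch n d :
  kpoly n d = \sum_(j < n.+1)
   ('C(n, j)%:R * (- (1 + a)) ^+ j * (- a) ^+ (n - j)
      * poch (d + 1 - n%:R) (n - j))
     *: poch (- 'X) j.
Proof.
elim: n d => [|n IHn] d.
  by rewrite big_ord1 /poch !big_ord0 bin0 !expr0 !mulr1 scale1r.
rewrite [kpoly _ _]/= IHn.
set e := d - 1 + 1 - n%:R.
have -> : d + 1 - n.+1%:R = e by rewrite /e -natr1; ring.
rewrite (raise_sum d n.+1 (fun j => 'C(n, j)%:R * (- (1 + a)) ^+ j *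
  (- a) ^+ (n - j) * poch e (n - j)) (fun j => poch (- 'X) j)).
(* A and B collect the two terms of raise_poch; Pascal's rule merges them. *)
pose B j := 'C(n, j)%:R * (- (1 + a)) ^+ j * (- a) ^+ (n.+1 - j)
  * poch e (n.+1 - j).
pose A j := 'C(n, j)%:R * (- (1 + a)) ^+ j.+1 * (- a) ^+ (n - j)
  * poch e (n - j).
transitivity (\sum_(j < n.+1) A j *: poch (- 'X : {poly R}) j.+1 +
              \sum_(j < n.+1) B j *: poch (- 'X : {poly R}) j).
  rewrite -big_split; apply: eq_bigr => j _ /=.
  rewrite raise_poch scalerDr !scalerA.
  have lejn : (j <= n)%N by rewrite -ltnS.
  rewrite /A /B subSn // (pochS e) !exprS /e natrB //.
  by congr (_ *: _ + _ *: _); ring.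
have -> : \sum_(j < n.+1) B j *: poch (- 'X) j
    = \sum_(j < n.+2) B j *: poch (- 'X : {poly R}) j.
  by rewrite [RHS]big_ord_recr /= [B n.+1]/B bin_small // !mul0r scale0r addr0.
rewrite [X in _ + X]big_ord_recl [RHS]big_ord_recl addrCA -big_split /=.
congr (_ + _); first by rewrite /B !bin0.
apply: eq_bigr => j _; rewrite /bump leq0n !add1n -scalerDl; congr (_ *: _).
rewrite /A /B binS natrD subSS; ring.
Qed.

Lemma poch_opp_nat n j : (j <= n)%N ->
  poch (- n%:R : R) j = (-1) ^+ j * 'C(n, j)%:R * j`!%:R.
Proof.
move=> lejn; rewrite -mulrA -natrM bin_ffact ffact_prod /poch natr_prod.
have -> : (-1) ^+ j = \prod_(i < j) (-1 : R) by rewrite prodr_const card_ord.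
rewrite -big_split; apply: eq_bigr => i _ /=.
by rewrite natrB ?(leq_trans (ltnW (ltn_ord i))) //; ring.
Qed.

Lemma kpoly_krawtchouk n d : a != 0 ->
  kpoly n d = (n`!%:R * (1 + a) ^+ n) *: krawtchouk a (d + 1) n.
Proof.
move=> a0; have nf : n`!%:R != 0 :> R by rewrite pnatr_eq0 -lt0n fact_gt0.
rewrite kpoly_poch /krawtchouk scalerA mulrAC mulfV // mul1r scaler_sumr.
apply: eq_bigr => j _; rewrite scalerA; congr (_ *: _).
have lejn : (j <= n)%N by rewrite -ltnS.
have jf : j`!%:R != 0 :> R by rewrite pnatr_eq0 -lt0n fact_gt0.
have en : (-1) ^+ (n + j) = (-1) ^+ (n - j) :> R.
  rewrite -{1}(subnK lejn) -addnA exprD addnn -mul2n exprM sqrrN.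
  by rewrite !expr1n mulr1.
rewrite poch_opp_nat // -[in (1 + a) ^+ n](subnKC lejn) exprD en.
rewrite [(- (1 + a)) ^+ _]exprNn [(- a) ^+ _]exprNn.
by field; rewrite jf !expf_neq0.
Qed.

(** Induction on the degree: subtracting a multiple of b_n removes the leading
    term. *)
Lemma vanish_on_basis (phi : {poly R} -> R) (b : nat -> {poly R}) :
  (forall c f g, phi (c *: f + g) = c * phi f + phi g) ->
  (forall n, (size (b n) <= n.+1)%N /\ (b n)`_n != 0) ->
  (forall n, phi (b n) = 0) -> forall g, phi g = 0.
Proof.
move=> lin bP b0 g.
have phi0 : phi 0 = 0.
  by have := lin (-1) 0 0; rewrite scaler0 addr0 mulN1r addNr.
have [n] := ubnP (size g); elim: n g => // n IHn g; rewrite ltnS => sg.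
case: n IHn sg => [|n] IHn sg.
  by move: sg; rewrite leqn0 size_poly_eq0 => /eqP->.
have [sb bn] := bP n.
have -> : g = (g`_n / (b n)`_n) *: b n + (g - (g`_n / (b n)`_n) *: b n).
  by rewrite addrC subrK.
rewrite lin b0 mulr0 add0r; apply: IHn; rewrite ltnS.
apply/leq_sizeP => j; rewrite leq_eqVlt => /orP[/eqP<-|lt].
  by rewrite coefB coefZ divfK // subrr.
rewrite coefB coefZ (nth_default _ (leq_trans sb lt)) mulr0 subr0.
by rewrite nth_default // (leq_trans sg lt).
Qed.

Lemma pearson_of_raise d nu : (forall g, nu (raise d g) = 0) -> pearson d nu.
Proof.
move=> h g; apply/eqP; rewrite -subr_eq0; apply/eqP.
by rewrite -(h g) /raise linearB linearZ.
Qed.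

(** Reindexing of the sum by (x + 1) binomial(M, x + 1) = (M - x) binomial(M,
    x); the boundary terms x = 0 and x = M vanish. *)
Lemma pearson_krawtchouk_measure M rho :
  rho =1 krawtchouk_measure a M -> pearson M%:R rho.
Proof.
move=> rhoE g; rewrite !rhoE /krawtchouk_measure mulrCA; congr (_ * _).
rewrite big_ord_recl [in RHS]big_ord_recr /= !evalE subrr !(mul0r, mulr0).
rewrite addr0 add0r mulr_sumr; apply: eq_bigr => i _.
have ltiM := ltn_ord i; rewrite /bump leq0n add1n !evalE.
have -> : (M - i = (M - i.+1).+1)%N by lia.
have -> : M%:R = (M - i.+1)%:R + i%:R + 1 :> R.
  by rewrite -natrD natr1; congr _%:R; lia.
have nf n : n`!%:R != 0 :> R by rewrite pnatr_eq0 -lt0n fact_gt0.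
rewrite exprS !factS !natrM -[i.+1%:R]natr1 addrK -[(M - i.+1).+1%:R]natr1.
by field; rewrite !nf !natr1 !pnatr_eq0.
Qed.

Lemma krawtchouk_measure1 M : krawtchouk_measure a M 1 = 1.
Proof.
rewrite /krawtchouk_measure.
have nf n : n`!%:R != 0 :> R by rewrite pnatr_eq0 -lt0n fact_gt0.
transitivity ((1 + a) ^- M * (1 + a) ^+ M); last by rewrite mulVf // expf_neq0.
rewrite [_ / _]mulrC -mulrA mulr_sumr; congr (_ * _); rewrite exprDn.
apply: eq_bigr => i _; rewrite horner1 expr1n mul1r.
have leiM : (i <= M)%N by rewrite -ltnS.
rewrite -(bin_fact leiM) -mulr_natr !natrM.
by field; rewrite !nf.
Qed.

(** When N is not a positive integer, rho is only known to annihilate the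
    Krawtchouk polynomials of positive degree; these are the images under the
    raising operator of a basis, so rho annihilates its whole range. *)
Lemma pearson_krawtchouk_functional N rho : a != 0 ->
  krawtchouk_functional a N rho -> pearson (N - 1) rho /\ rho 1 = 1.
Proof.
move=> a0 [rhoM rho_orth].
have [[M NM]|] := pselect (exists M : nat, N = M.+1%:R).
  rewrite NM -natr1 addrK; split.
    exact: pearson_krawtchouk_measure (rhoM M NM).
  by rewrite (rhoM M NM) krawtchouk_measure1.
move=> noM; have [orth rho1] := rho_orth (fun M e => noM (ex_intro _ M e)).
split=> //; apply: pearson_of_raise.
apply: (@vanish_on_basis (fun g => rho (raise (N - 1) g))
                         (fun n => kpoly n (N - 1 - 1))).
- by move=> c f g; rewrite raise_linear linearP.
- by move=> n; have [sk ->] := size_coef_kpoly n (N - 1 - 1); rewrite expf_neq0.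
move=> n; rewrite -[raise _ _]/(kpoly n.+1 (N - 1)).
rewrite kpoly_krawtchouk // subrK linearZ /=.
by have [_ /(_ 0%N isT)] := orth n.+1 isT; rewrite mulr1 => -> _; rewrite mulr0.
Qed.

(** * Difference operators and their extreme coefficients *)

Section Operators.
Implicit Types (D : {poly R} -> {poly R}) (s l : int) (lo hi p : {poly R}).

(** D is a difference operator with shifts s, ..., s + n, whose extreme
    coefficients are lo and hi. They may be zero, so that operators of smaller
    genre can be added on a common window; this bookkeeping is what determines
    the genre of a polynomial in a second-order operator. *)
Definition windowed s n D lo hi := exists c : nat -> {poly R},
  [/\ c 0%N = lo, c n = hi &
      forall p, D p = \sum_(i < n.+1) c i * shiftp (s + i%:Z) p].

Lemma windowedZ s n D lo hi : windowed s n D lo hi ->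
  forall c p, D (c *: p) = c *: D p.
Proof.
case=> f [_ _ DE] c p; rewrite !DE scaler_sumr; apply: eq_bigr => i _.
by rewrite /shiftp linearZ scalerAr.
Qed.

Lemma windowedD s n D lo hi : windowed s n D lo hi ->
  forall p q, D (p + q) = D p + D q.
Proof.
case=> f [_ _ DE] p q; rewrite !DE -big_split; apply: eq_bigr => i _ /=.
by rewrite /shiftp linearD mulrDr.
Qed.

Lemma windowed_add s n D1 D2 lo1 lo2 hi1 hi2 :
  windowed s n D1 lo1 hi1 -> windowed s n D2 lo2 hi2 ->
  windowed s n (fun p => D1 p + D2 p) (lo1 + lo2) (hi1 + hi2).
Proof.
move=> [f1 [<- <- D1E]] [f2 [<- <- D2E]].
exists (fun i => f1 i + f2 i); split=> // p.
by rewrite D1E D2E -big_split; apply: eq_bigr => i _; rewrite mulrDl.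
Qed.

Lemma windowed_extendl s n D lo hi :
  windowed s n D lo hi -> windowed (s - 1) n.+1 D 0 hi.
Proof.
move=> [f [_ <- DE]]; exists (fun i => if i is m.+1 then f m else 0).
split=> // p.
rewrite DE [RHS]big_ord_recl mul0r add0r; apply: eq_bigr => i _ /=.
by rewrite /bump leq0n add1n; congr (_ * shiftp _ _); lia.
Qed.

Lemma windowed_extendr s n D lo hi :
  windowed s n D lo hi -> windowed s n.+1 D lo 0.
Proof.
move=> [f [<- _ DE]]; exists (fun i => if (i <= n)%N then f i else 0).
split=> [||p]; rewrite ?leq0n ?ltnn // DE [RHS]big_ord_recr /= ltnn mul0r addr0.
by apply: eq_bigr => i _; rewrite -ltnS ltn_ord.
Qed.

Lemma windowed_mulshift g l s n D lo hi : windowed s n D lo hi ->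
  windowed (s + l) n (fun p => g * shiftp l (D p))
    (g * shiftp l lo) (g * shiftp l hi).
Proof.
move=> [f [<- <- DE]]; exists (fun i => g * shiftp l (f i)); split=> // p.
rewrite DE /shiftp linear_sum mulr_sumr; apply: eq_bigr => i _ /=.
rewrite -!/(shiftp _ _) shiftpM shiftp_shiftp mulrA.
by congr (_ * shiftp _ _); lia.
Qed.

Lemma windowed_scale c n : windowed (- n.+1%:Z) n.+1.*2 ( *:%R c) 0 0.
Proof.
elim: n => [|n IHn].
  have W0 : windowed 0 0 ( *:%R c) c%:P c%:P.
    exists (fun=> c%:P); split=> // p.
    by rewrite big_ord1 shiftp0 mul_polyC.
  by have := windowed_extendl (windowed_extendr W0).
have := windowed_extendl (windowed_extendr IHn).
by rewrite doubleS (_ : - n.+1%:Z - 1 = - n.+2%:Z) //; lia.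
Qed.

Variables cm c0 cp : {poly R}.

Definition second_order p := cm * shiftp (-1) p + c0 * p + cp * shiftp 1 p.

Lemma second_orderZ c p : second_order (c *: p) = c *: second_order p.
Proof. by apply: poly_ext => x; rewrite !evalE; ring. Qed.

Lemma windowed_second_order s n D lo hi : windowed s n D lo hi ->
  windowed (s - 1) n.+2 (fun p => second_order (D p))
    (cm * shiftp (-1) lo) (cp * shiftp 1 hi).
Proof.
move=> W.
have := windowed_extendr (windowed_extendr (windowed_mulshift cm (-1) W)).
have := windowed_extendl (windowed_extendr (windowed_mulshift c0 0 W)).
have := windowed_extendl (windowed_extendl (windowed_mulshift cp 1 W)).
rewrite addrK addr0 => Wp W0 Wm.
have := windowed_add (windowed_add Wm W0) Wp; rewrite !addr0 !add0r.
case=> f [f0 fn fE]; exists f; split=> // p.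
by rewrite -fE /second_order shiftp0.
Qed.

(** [lowc n] and [highc n] are the extreme coefficients of the n-th power of
    the second-order operator. *)
Fixpoint lowc n := if n is m.+1 then cm * shiftp (-1) (lowc m) else 1.
Fixpoint highc n := if n is m.+1 then cp * shiftp 1 (highc m) else 1.

Lemma lowc_neq0 n : cm != 0 -> lowc n != 0.
Proof.
move=> cm0; elim: n => [|n IHn] /=; first exact: oner_neq0.
by rewrite mulf_neq0 // -size_poly_eq0 size_shiftp size_poly_eq0.
Qed.

Lemma highc_neq0 n : cp != 0 -> highc n != 0.
Proof.
move=> cp0; elim: n => [|n IHn] /=; first exact: oner_neq0.
by rewrite mulf_neq0 // -size_poly_eq0 size_shiftp size_poly_eq0.
Qed.

(** Functional calculus: the operator P(T), for T of genre (-1, 1), is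
    described only by its action on eigenvectors of T; its extreme
    coefficients come from the leading term of P alone. *)
Lemma windowed_poly (P : {poly R}) n : (size P <= n.+1)%N ->
  exists D, windowed (- n%:Z) n.*2 D (P`_n *: lowc n) (P`_n *: highc n) /\
    forall z p, second_order p = z *: p -> D p = P.[z] *: p.
Proof.
elim/poly_ind: P n => [|P c IHP] n sP.
  exists (fun=> 0); split; last by move=> z p _; rewrite horner0 scale0r.
  exists (fun=> 0); rewrite coef0 !scale0r; split=> // p.
  by rewrite big1 // => i _; rewrite mul0r.
case: n sP => [|n] sP.
  exists ( *:%R c); split.
    exists (fun=> c%:P); rewrite coefD coefMX coefC /= add0r -!mul_polyC !mulr1.
    by split=> // p; rewrite big_ord1 shiftp0 mul_polyC.
  have -> : P = 0.
    by move: sP; rewrite size_MXaddC; case: eqVneq => // P0 /=;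
      rewrite ltnS leqn0 size_poly_eq0 => /eqP e; rewrite e eqxx in P0.
  by move=> z p _; rewrite mul0r add0r hornerC.
have sP' : (size P <= n.+1)%N.
  by move: sP; rewrite size_MXaddC; case: eqVneq => [->|//]; rewrite size_poly0.
have [D [W DP]] := IHP n sP'.
exists (fun p => second_order (D p) + c *: p); split.
  have n1 : - n.+1%:Z = - n%:Z - 1 by lia.
  have Wc := windowed_scale c n; rewrite n1 doubleS in Wc.
  have := windowed_add (windowed_second_order W) Wc.
  rewrite !addr0 coefD coefMX coefC addr0 n1 doubleS.
  by rewrite /shiftp !linearZ /= !scalerAr.
move=> z p Tp; rewrite (DP z) // second_orderZ Tp scalerA -scalerDl.
by rewrite hornerMXaddC.
Qed.

End Operators.

Lemma windowed_genre s n D lo hi : lo != 0 -> hi != 0 -> windowed s n D lo hi ->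
  has_genre D s (s + n%:Z).
Proof.
move=> lo0 hi0 [f [f0 fn fE]]; split; first by rewrite lerDl.
exists (fun z => f `|z - s|%N); have e (i : nat) : `|(s + i%:Z)%R - s|%N = i.
  by rewrite addrAC subrr add0r.
rewrite e subrr /= f0 fn; split=> // p; rewrite fE /diff_op e.
by apply: eq_bigr => i _; rewrite e.
Qed.

(** * The orthogonal polynomials of p_F rho *)

(** Uniqueness of orthogonal polynomials: testing r of degree m < n against
    q_m gives its leading coefficient times a nonzero norm. *)
Lemma orthogonal_polys_vanish mu K (q : nat -> {poly R}) n r :
  orthogonal_polys mu K q -> in_range K n -> (size r <= n)%N ->
  (forall m, (m < n)%N -> mu (r * 'X^m) = 0) -> r = 0.
Proof.
move=> orth Kn sr rorth.
have mur (f : {poly R}) : (size f <= n)%N -> mu (r * f) = 0.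
  move=> sf; rewrite -[f]coefK poly_def mulr_sumr linear_sum big1 // => i _.
  by rewrite -scalerAr linearZ /= rorth ?mulr0 // (leq_trans _ sf).
apply/eqP/negPn/negP => r0; have := r0; rewrite -size_poly_gt0.
case E: (size r) => [//|m] _; have ltmn : (m < n)%N by rewrite -E.
have Km : in_range K m.
  by case: K Kn {orth} => //= K; apply: leq_trans; exact: ltnW.
have [sq qorth qn] := orth m Km.
have : mu (r * q m) = 0 by rewrite mur // sq.
have -> : r = r`_m *: 'X^m + \sum_(i < m) r`_i *: 'X^i.
  by rewrite -[LHS]coefK poly_def E big_ord_recr addrC.
rewrite mulrDl linearD mulr_suml linear_sum big1 => [|i _]; last first.
  by rewrite -scalerAl linearZ /= ['X^_ * _]mulrC qorth ?mulr0.
rewrite addr0 -scalerAl linearZ /= ['X^_ * _]mulrC => /eqP.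
rewrite mulf_eq0 (negbTE qn) orbF.
by rewrite -[m]/(m.+1.-1) -E -lead_coefE lead_coef_eq0 (negbTE r0).
Qed.

(** The candidates for the orthogonal polynomials of p_F rho. The ratio of the
    two coefficients is forced by orthogonality to 1, and clearing
    denominators makes both polynomial in n. At n = 0 the factor n cancels the
    second term, where [n.-1] is a dummy index. *)
Definition christoffel_poly d k n : {poly R} :=
  (dual_kpoly d k).[- n%:R] *: shifted_kpoly d k.+1 n +
  (n%:R * (dual_kpoly d k).[- n.+1%:R]) *: shifted_kpoly d k.+1 n.-1.

Lemma size_coef_shifted_kpoly d j n :
  (size (shifted_kpoly d j n) <= n.+1)%N /\
  (shifted_kpoly d j n)`_n = (1 + a) ^+ n.
Proof.
have [sk ck] := size_coef_kpoly n (d - j%:R).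
by rewrite size_shiftp coef_shiftp.
Qed.

Lemma size_coef_christoffel_poly d k n :
  (size (christoffel_poly d k n) <= n.+1)%N /\
  (christoffel_poly d k n)`_n = (dual_kpoly d k).[- n%:R] * (1 + a) ^+ n.
Proof.
have [sk ck] := size_coef_shifted_kpoly d k.+1 n.
have [sk' _] := size_coef_shifted_kpoly d k.+1 n.-1; split.
  rewrite (leq_trans (size_polyD _ _)) // geq_max; apply/andP; split;
    apply: leq_trans (size_scale_leq _ _) _ => //.
  by apply: leq_trans sk' _; rewrite ltnS leq_pred.
rewrite coefD !coefZ ck; case: n {sk ck} sk' => [|n] sk'.
  by rewrite mul0r mul0r addr0.
by rewrite (nth_default _ sk') mulr0 addr0.
Qed.

Lemma pearson_christoffel_poly0 d nu k n : pearson d nu ->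
  nu (pF R k * christoffel_poly d k n.+1) = 0.
Proof.
move=> P; rewrite mulrDr linearD -!scalerAr !linearZ /= !pearson_pF //.
by rewrite factS natrM exprS; ring.
Qed.

(** A factor x turns p_F into [falling_poly k.+1], for which the two
    Krawtchouk polynomials are orthogonal to every degree below n. *)
Lemma pearson_christoffel_polyX d nu k n m : pearson d nu -> (m <= n)%N ->
  nu (pF R k * (christoffel_poly d k n.+1 * 'X^(m.+1))) =
    (m == n)%:R * (n.+1%:R * (dual_kpoly d k).[- n.+2%:R] *
     ((a / (1 + a)) ^+ n * falling (d - k.+1%:R) n * n`!%:R)
      * ((a / (1 + a)) ^+ k.+1 * falling d k.+1 * nu 1)).
Proof.
move=> P lemn.
have -> : pF R k * (christoffel_poly d k n.+1 * 'X^(m.+1)) =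
    (dual_kpoly d k).[- n.+1%:R] *:
      (falling_poly k.+1 * (shifted_kpoly d k.+1 n.+1 * 'X^m)) +
    (n.+1%:R * (dual_kpoly d k).[- n.+2%:R]) *:
      (falling_poly k.+1 * (shifted_kpoly d k.+1 n * 'X^m)).
  by rewrite falling_poly_pF exprS /christoffel_poly -!mul_polyC; ring.
rewrite linearD !linearZ /= !pearson_shifted_kpoly ?size_polyXn ?ltnS //;
  last exact: leqW.
rewrite !coefXn gtn_eqF ?ltnS // [n == m]eq_sym.
by rewrite -[false%:R]/(0 : R); move: ((m == n)%:R : R) => b; ring.
Qed.

Lemma pearson_christoffel_poly_lt d nu k n m : pearson d nu -> (m < n)%N ->
  mulmf (pF R k) nu (christoffel_poly d k n * 'X^m) = 0.
Proof.
move=> P; case: n => // n; rewrite ltnS /mulmf.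
case: m => [|m] ltmn; first by rewrite mulr1 pearson_christoffel_poly0.
by rewrite pearson_christoffel_polyX ?(ltnW ltmn) // ltn_eqF // mul0r.
Qed.

Lemma christoffel_poly_orthogonal d nu k K :
  pearson d nu -> nu 1 != 0 -> a != 0 ->
  falling d k.+1 != 0 -> (forall n, (dual_kpoly d k).[- n%:R] != 0) ->
  (forall n, in_range K n.+1 -> falling (d - k.+1%:R) n != 0) ->
  orthogonal_polys (mulmf (pF R k) nu) K (christoffel_poly d k).
Proof.
move=> P nu1 a0 dk Y0 dn n Kn; have [sq cq] := size_coef_christoffel_poly d k n.
have sqE : size (christoffel_poly d k n) = n.+1.
  apply/eqP; rewrite eqn_leq sq ltnNge; apply/negP => sqn.
  move: cq; rewrite nth_default // => /esym/eqP.
  by rewrite mulf_eq0 (negbTE (Y0 n)) expf_eq0 (negbTE a1) andbF.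
have nf m : m`!%:R != 0 :> R by rewrite pnatr_eq0 -lt0n fact_gt0.
have th0 : a / (1 + a) != 0 by rewrite mulf_neq0 ?invr_eq0.
split=> //.
- by move=> m ltmn; exact: pearson_christoffel_poly_lt.
case: n Kn {sq cq sqE} => [_|n Kn]; rewrite /= /mulmf.
  rewrite /christoffel_poly mul0r scale0r addr0 mulr1.
  rewrite -scalerAr linearZ /= pearson_pF //.
  by rewrite expr0 fact0 mulr1 mul1r !mulf_neq0.
rewrite pearson_christoffel_polyX // eqxx mul1r.
rewrite !mulf_neq0 ?expf_neq0 ?pnatr_eq0 //; first exact: dn.
by rewrite -lt0n fact_gt0.
Qed.

(** * The operator with the orthogonal polynomials as eigenfunctions *)

Section DifferenceOperator.
Variables (d : R) (k : nat).

(** The coefficients of [raise \o fdiff], translated by k + 1 and divided by 1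
    + a so that the eigenvalues are the integers n. *)
Let cm : {poly R} := (1 + a)^-1 *: ((k.+1%:R)%:P - 'X).
Let cp : {poly R} := (- (a / (1 + a))) *: (d%:P - 'X).
Let c0 : {poly R} := - (cm + cp).

Lemma second_order_shifted_kpoly n :
  second_order cm c0 cp (shifted_kpoly d k.+1 n) =
  n%:R *: shifted_kpoly d k.+1 n.
Proof.
have e := kpoly_eigen n (d - k.+1%:R).
have -> : n%:R *: shifted_kpoly d k.+1 n =
    (1 + a)^-1 *: shiftp (- k.+1%:Z)
       (raise (d - k.+1%:R) (fdiff (kpoly n (d - k.+1%:R)))).
  by rewrite e /shifted_kpoly /shiftp linearZ /= scalerA mulKf.
apply: poly_ext => x; rewrite /second_order /shifted_kpoly /c0 /cm /cp !evalE.
have -> : x + (- k.+1%:Z)%:~R - 1 + 1 = x + (- k.+1%:Z)%:~R by rewrite subrK.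
have -> : x + (-1)%:~R + (- k.+1%:Z)%:~R = x + (- k.+1%:Z)%:~R - 1.
  by rewrite addrAC.
have -> : x + 1%:~R + (- k.+1%:Z)%:~R = x + (- k.+1%:Z)%:~R + 1.
  by rewrite addrAC.
set g := kpoly n _; set y := x + _.
have -> : x = y + k.+1%:R by rewrite /y rmorphN subrK.
by field; exact: a1.
Qed.

(** On generating functions the backward shift multiplies by (1 - a t) / (1 +
    t); clearing the denominator gives a relation with two terms on each side,
    of the same shape as [christoffel_poly]. *)
Lemma backshift_shifted_kpoly n :
  shiftp (-1) (shifted_kpoly d k.+1 n + n%:R *: shifted_kpoly d k.+1 n.-1) =
  shifted_kpoly d k.+1 n - (a * n%:R) *: shifted_kpoly d k.+1 n.-1.
Proof.
case: n => [|n].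
  by rewrite mulr0 !scale0r subr0 addr0; apply: poly_ext => x; rewrite !evalE.
rewrite -shifted_kpoly_rec /shifted_kpoly shiftp_shiftp.
have -> : d - k%:R = d - k.+1%:R + 1 by rewrite -natr1; ring.
rewrite kpoly_contiguous (_ : -1 - k%:Z = - k.+1%:Z); last by lia.
by rewrite /shiftp linearB linearZ.
Qed.

(** The operator is P(L) + s_(-1) Y(L). On the combination of p_n and p_(n-1)
    it multiplies the first term by P(n) + Y(n) and the second one by P(n-1) -
    a Y(n-1); [P_step] makes these equal. The antidifference P is explicit
    because dual polynomials are differences of dual polynomials. *)
Let Y : {poly R} := dual_kpoly d k \Po (- 'X - 1%:P).
Let P : {poly R} := k.+1%:R^-1 *:
  (dual_kpoly d k.+1 \Po (- 'X - 1%:P)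
   + a *: (dual_kpoly d k.+1 \Po (- 'X - 0%:P))).

Let horner_reflect f c x : (f \Po (- 'X - c%:P)).[x] = f.[- x - c].
Proof. by rewrite horner_comp hornerD !hornerN hornerX hornerC. Qed.

Let hornerY n : Y.[n%:R] = (dual_kpoly d k).[- n.+1%:R].
Proof.
by rewrite horner_reflect; congr (horner _ _); rewrite -[n.+1%:R]natr1; ring.
Qed.

Let hornerP x :
  P.[x] =
  k.+1%:R^-1 * ((dual_kpoly d k.+1).[- x - 1] + a * (dual_kpoly d k.+1).[- x]).
Proof. by rewrite hornerZ hornerD hornerZ !horner_reflect subr0. Qed.

Let P_step n : P.[n.+1%:R] - P.[n%:R] = - Y.[n.+1%:R] - a * Y.[n%:R].
Proof.
have dual x : (dual_kpoly d k.+1).[x + 1] - (dual_kpoly d k.+1).[x]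
    = k.+1%:R * (dual_kpoly d k).[x].
  by rewrite -horner_fdiff fdiff_dual_kpoly hornerZ.
have := dual (- n.+2%:R); have := dual (- n.+1%:R); rewrite !hornerY.
have -> : - n.+2%:R + 1 = - n.+1%:R :> R by rewrite -[n.+2%:R]natr1; ring.
have -> : - n.+1%:R + 1 = - n%:R :> R by rewrite -[n.+1%:R]natr1; ring.
move=> e1 e2; rewrite !hornerP.
have -> : - n.+1%:R - 1 = - n.+2%:R :> R by rewrite -[n.+2%:R]natr1; ring.
have -> : - n%:R - 1 = - n.+1%:R :> R by rewrite -[n.+1%:R]natr1; ring.
have k0 : k.+1%:R != 0 :> R by rewrite pnatr_eq0.
apply: (mulfI k0); rewrite -mulrBr mulrA mulfV // mul1r.
rewrite mulrBr mulrN [_ * (a * _)]mulrCA -e1 -e2; ring.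
Qed.

Let size_coef_dual_kpoly j :
  (size (dual_kpoly d j) <= j.+1)%N /\ (dual_kpoly d j)`_j = 1.
Proof.
have [sk ck] := size_coef_kpoly j (j%:R - 1 - d).
split; first exact: leq_trans (size_scale_leq _ _) sk.
by rewrite coefZ ck mulVf // expf_neq0.
Qed.

Let deg_reflection c :
  size (- 'X - c%:P : {poly R}) = 2%N /\
  lead_coef (- 'X - c%:P : {poly R}) = -1.
Proof. by rewrite -opprD size_polyN lead_coefN size_XaddC lead_coefXaddC. Qed.

(** Homogeneity is recorded because orthogonal polynomials are determined only
    up to a constant factor. *)
Lemma difference_operator : a != 0 -> exists D lam,
  [/\ has_genre D (- (k%:Z) - 1) (k%:Z + 1),
      forall c p, D (c *: p) = c *: D p
    & forall n, D (christoffel_poly d k n) = lam n *: christoffel_poly d k n].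
Proof.
move=> a0; have [sY cY] := size_coef_dual_kpoly k.
have [sP cP] := size_coef_dual_kpoly k.+1.
have [s1 l1] := deg_reflection 1; have [s0 l0] := deg_reflection 0.
have {sY cY} [sY cY] : (size Y <= k.+1)%N /\ Y`_k = (-1) ^+ k.
  by rewrite /Y coef_comp_linear // cY mul1r l1 size_comp_poly2.
have {sP cP} [sP cP] : (size P <= k.+2)%N /\
    P`_k.+1 = (-1) ^+ k.+1 * ((1 + a) / k.+1%:R).
  split.
    rewrite (leq_trans (size_scale_leq _ _)) //.
    rewrite (leq_trans (size_polyD _ _)) // geq_max.
    rewrite size_comp_poly2 // sP /= (leq_trans (size_scale_leq _ _)) //.
    by rewrite size_comp_poly2.
  by rewrite /P coefZ coefD coefZ !coef_comp_linear // cP l0 l1; ring.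
have [DP [WP DPE]] := windowed_poly cm c0 cp sP.
have [DY [WY DYE]] := windowed_poly cm c0 cp sY.
(* The back shift of Y(L) lives on -(k+1), ..., k-1, two short on the right. *)
have := windowed_extendr (windowed_extendr (windowed_mulshift 1 (-1) WY)).
have k1 : - k.+1%:Z = - k%:Z - 1 by lia.
rewrite k1 doubleS in WP => /(windowed_add WP).
set D := fun p => _; set lo := _ *: lowc _ _ + _.
set hi := _ *: highc _ _ + 0 => W.
have cm0 : cm != 0.
  by rewrite scaler_eq0 invr_eq0 negb_or a1 -opprB oppr_eq0 polyXsubC_eq0.
have cp0 : cp != 0.
  rewrite scaler_eq0 oppr_eq0 mulf_eq0 invr_eq0 !negb_or a0 a1.
  by rewrite -opprB oppr_eq0 polyXsubC_eq0.
have Pk0 : P`_k.+1 != 0.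
  by rewrite cP mulf_neq0 ?signr_eq0 // mulf_neq0 ?invr_eq0 ?pnatr_eq0.
exists D, (fun n => P.[n%:R] + Y.[n%:R]); split.
- have -> : k%:Z + 1 = - k%:Z - 1 + (k.*2.+2)%:Z by lia.
  apply: windowed_genre W.
    (* L^(k+1) and the back shift of L^k both reach the shift -(k+1), but their
       coefficients have different degrees and cannot cancel. *)
    have -> : lo = (P`_k.+1 *: cm + (Y`_k)%:P) * shiftp (-1) (lowc cm k).
      by rewrite /lo /= shiftpZ -!mul_polyC; ring.
    rewrite mulf_neq0 //; last first.
      by rewrite -size_poly_eq0 size_shiftp size_poly_eq0 lowc_neq0.
    move: (P`_k.+1) (Y`_k) Pk0 => pk yk pk0; apply/eqP => /polyP/(_ 1%N)/eqP.
    rewrite coef0 coefD !coefZ coefB !coefC coefX /= addr0 sub0r.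
    by rewrite mulrN1 mulrN oppr_eq0 mulf_eq0 invr_eq0 (negbTE pk0) (negbTE a1).
  by rewrite /hi addr0 scaler_eq0 negb_or Pk0 highc_neq0.
- exact: windowedZ W.
move=> n; rewrite /D mul1r (windowedD WP) !(windowedZ WP).
rewrite (windowedD WY) !(windowedZ WY).
rewrite !(DPE _ _ (second_order_shifted_kpoly _)).
rewrite !(DYE _ _ (second_order_shifted_kpoly _)) hornerY.
(* Y(L) multiplies the coefficient dual(-n) of p_n by Y(n) = dual(-n-1), and the
   coefficient n dual(-n-1) of p_(n-1) by Y(n-1) = dual(-n), so both acquire the
   same product and the backward shift applies to p_n + n p_(n-1). *)
have -> : (dual_kpoly d k).[- n%:R] *:
      ((dual_kpoly d k).[- n.+1%:R] *: shifted_kpoly d k.+1 n)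
  + (n%:R * (dual_kpoly d k).[- n.+1%:R]) *:
      (Y.[n.-1%:R] *: shifted_kpoly d k.+1 n.-1)
  = ((dual_kpoly d k).[- n%:R] * (dual_kpoly d k).[- n.+1%:R])
      *: (shifted_kpoly d k.+1 n + n%:R *: shifted_kpoly d k.+1 n.-1).
  case: n => [|n]; first by rewrite !mul0r !scale0r !addr0 scalerA.
  by rewrite hornerY -!mul_polyC !polyCM; ring.
rewrite shiftpZ backshift_shifted_kpoly /christoffel_poly.
case: n => [|n].
  rewrite !(mul0r, mulr0, scale0r, addr0, subr0) !scalerA -scalerDl.
  by congr (_ *: _); ring.
have /eqP := P_step n; rewrite subr_eq !hornerY => /eqP ->.
by rewrite -!mul_polyC !(polyCM, polyCD, polyCN); ring.
Qed.

End DifferenceOperator.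
End Krawtchouk.

Theorem corollary6p5 (R : realType) (k : nat) (a N : R)
    (rho : {scalar {poly R}})
    (k_gt0 : (0 < k)%N)
    (a_neq0 : a != 0) (a_neqN1 : a != -1)
    (N_neq : forall j : nat, (1 <= j <= k.+1)%N -> N != j%:R)
    (kraw_neq0 : forall n : nat, (1 <= n)%N ->
       (krawtchouk a (- N + k%:R + 1) k).[- n%:R] != 0)
    (rhoP : krawtchouk_functional a N rho) :
  [/\ (* the family is finite when N is a positive integer: p_F rho_{a,N} is
         then supported on the N - k points 0, k + 1, ..., N - 1 *)
      forall M : nat, N = M.+1%:R ->
        exists q : nat -> {poly R},
          orthogonal_polys (mulmf (pF R k) rho) (Some (M - k)%N) q,
      (* and infinite otherwise *)
      (forall M : nat, N <> M.+1%:R) ->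
        exists q : nat -> {poly R},
          orthogonal_polys (mulmf (pF R k) rho) None q
    & exists (D : {poly R} -> {poly R}) (lambda : nat -> R),
        [/\ has_order D (2 * k + 2),
            has_genre D (- (k%:Z) - 1) (k%:Z + 1)
          & forall (K : option nat) (q : nat -> {poly R}),
              orthogonal_polys (mulmf (pF R k) rho) K q ->
              forall n : nat, in_range K n -> D (q n) = lambda n *: q n]].
Proof.
have a1 : 1 + a != 0 by rewrite addrC addr_eq0.
have [P rho1] := pearson_krawtchouk_functional a1 a_neq0 rhoP.
have dk : falling (N - 1) k.+1 != 0.
  apply/prodf_neq0 => i _; rewrite -addrA -opprD [1 + _]addrC natr1 subr_eq0.
  by apply: N_neq; rewrite /= ltn_ord.
(* At n = 0 this comes from the values excluded for N, at n >= 1 from the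
   nonvanishing of the Krawtchouk polynomial. *)
have Y0 n : (dual_kpoly a (N - 1) k).[- n%:R] != 0.
  case: n => [|n].
    rewrite oppr0 dual_kpoly_at0 // mulf_neq0 // ?expf_neq0 ?mulf_neq0
      ?invr_eq0 //.
    by move: dk; rewrite /falling big_ord_recr /= mulf_eq0 negb_or => /andP[].
  rewrite hornerZ kpoly_krawtchouk // hornerZ.
  rewrite !mulf_neq0 ?invr_eq0 ?expf_neq0 //.
    by rewrite pnatr_eq0 -lt0n fact_gt0.
  have -> : k%:R - 1 - (N - 1) + 1 = - N + k%:R + 1 by ring.
  exact: kraw_neq0.
have orth K :
    (forall n i, in_range K n.+1 -> (i < n)%N -> N != (i + k.+2)%:R) ->
    orthogonal_polys (mulmf (pF R k) rho) K (christoffel_poly a (N - 1) k).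
  move=> hN; apply: christoffel_poly_orthogonal => //.
    by rewrite rho1 oner_neq0.
  move=> n Kn; apply/prodf_neq0 => i _.
  have -> : N - 1 - k.+1%:R - i%:R = N - (i + k.+2)%:R.
    by rewrite natrD -[k.+2%:R]natr1; ring.
  by rewrite subr_eq0 (hN n).
split.
- move=> M NM; exists (christoffel_poly a (N - 1) k).
  apply: orth => n i /= Kn ltin.
  by rewrite NM eqr_nat; lia.
- move=> noM; exists (christoffel_poly a (N - 1) k); apply: orth => n i _ _.
  by apply/eqP; rewrite addnS; exact: noM.
have [D [lam [genre DZ DQ]]] := difference_operator a1 (N - 1) k a_neq0.
exists D, lam; split=> //.
  by exists (- k%:Z - 1), (k%:Z + 1); split=> //; lia.
move=> K q qorth n Kn; have [sq cq] := size_coef_christoffel_poly a (N - 1) k n.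
have [sqn qn_orth _] := qorth n Kn.
set Q := christoffel_poly a (N - 1) k n in sq cq *.
have Qn0 : Q`_n != 0 by rewrite cq mulf_neq0 ?expf_neq0.
(* The combination cancelling the leading terms has degree below n and is
   orthogonal to all lower degrees. *)
have : Q`_n *: q n - (q n)`_n *: Q = 0.
  apply: (orthogonal_polys_vanish qorth Kn).
    apply/leq_sizeP => j; rewrite leq_eqVlt => /orP[/eqP<-|lt].
      by rewrite coefB !coefZ mulrC subrr.
    rewrite coefB !coefZ (nth_default _ (leq_trans sq lt)).
    by rewrite [(q n)`_j]nth_default ?sqn // !mulr0 subrr.
  move=> m ltmn; rewrite mulrBl -!scalerAl linearB !linearZ /=.
  by rewrite qn_orth // pearson_christoffel_poly_lt // !mulr0 subrr.
move=> /eqP; rewrite subr_eq0 => /eqP e.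
apply: (scalerI Qn0); rewrite -DZ e DZ DQ -/Q.
by rewrite scalerA mulrC -scalerA -e !scalerA mulrC.
Qed.
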